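(* Suppose $B$ and $B'$ are nonempty sets, $S=\{S_b\mid b\in B\}$ is a family of subgroups of $\mathbb Z_B$ with $b\in S_b$ for all $b\in B$, and $S'=\{S'_{b'}\mid b'\in B'\}$ is a family of subgroups of $\mathbb Z_{B'}$ with $b'\in S'_{b'}$ for all $b'\in B'$. Then $Q(S)\cong Q(S')$ if and only if there is a bijection $f:B\to B'$ with $f(S_b)=S'_{f(b)}$ for all $b\in B$, where $f$ also denotes the induced homomorphism $\mathbb Z_B\to\mathbb Z_{B'}$.
   Context: A quandle is a set $Q$ with a binary operation $\triangleright$ such that: $x\triangleright x=x$ for all $x$; for each $y\in Q$ the map $x\mapsto x\triangleright y$ is a bijection $Q\to Q$; and $(w\triangleright x)\triangleright y=(w\triangleright y)\triangleright(x\triangleright y)$ for all $w,x,y$. A quandle isomorphism ($\cong$) is a bijection preserving $\triangleright$. For a nonempty set $B$, $\mathbb Z_B$ is the free abelian group on $B$. If $S=\{S_b\mid b\in B\}$ is a family of subgroups of $\mathbb Z_B$ with $b\in S_b$ for all $b\in B$, put $A_b=\mathbb Z_B/S_b$; then $Q(S)$ is the disjoint union $\bigcup_{b\in B}A_b$ with operation $x\triangleright y=x+(c+S_b)\in A_b$ for $x\in A_b$, $y\in A_c$; this is a quandle. *)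

(* Defs.v *)
(* Sets are choiceTypes, and the free abelian group on B is {freeg B}, i.e.
   {freeg B / int}, in which <<b>> is the generator b : B. *)
From HB Require Import structures.
From mathcomp Require Import all_boot all_order all_algebra.
From mathcomp Require Import generic_quotient ring_quotient.
From mathcomp Require Import classical_sets.
From mathcomp.multinomials Require Import freeg.

Set Implicit Arguments.
Unset Strict Implicit.
Unset Printing Implicit Defensive.

Import GRing.Theory.
Local Open Scope ring_scope.
Local Open Scope quotient_scope.

Record quandle := Quandle {
  qcarrier :> Type;
  qop : qcarrier -> qcarrier -> qcarrier;
  qop_idem : forall x, qop x x = x;
  qop_bij : forall y, bijective (fun x => qop x y);
  qop_distr : forall w x y, qop (qop w x) y = qop (qop w y) (qop x y)
}.

Definition quandle_iso (Q Q' : quandle) : Prop :=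
  exists2 g : Q -> Q', bijective g & {morph g : x y / qop x y >-> qop x y}.

(* Despite its name, {ideal_quot H} is the quotient of a zmodType by any
   additive subgroup H : zmodClosed, with \pi_{ideal_quot H} the projection;
   no ideal structure is involved. *)
Definition QS_carrier (B : choiceType) (S : B -> zmodClosed {freeg B}) : Type :=
  {b : B & {ideal_quot S b}}.

(* For x in A_b and y in A_c, the result is x + (c + S_b) in A_b: it depends
   on y only through its index c = tag y. *)
Definition QS_op (B : choiceType) (S : B -> zmodClosed {freeg B})
    (x y : QS_carrier S) : QS_carrier S :=
  Tagged (fun b => {ideal_quot S b})
    (tagged x + \pi_({ideal_quot S (tag x)}) << tag y >>).

Lemma QS_op_idem (B : choiceType) (S : B -> zmodClosed {freeg B}) :
  (forall b, << b >> \in S b) -> forall x : QS_carrier S, QS_op x x = x.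
Proof.
move=> S_diag [b a]; rewrite /QS_op /=; congr (Tagged _ _).
suff -> : \pi_({ideal_quot S b}) << b >> = 0 by rewrite addr0.
have <- : \pi_({ideal_quot S b}) 0 = 0.
  exact: (@pi_zeror _ _ _ _ _ {ideal_quot S b}).
by apply/eqP; rewrite -Quotient.idealrBE subr0.
Qed.

Lemma QS_op_bij (B : choiceType) (S : B -> zmodClosed {freeg B})
  (y : QS_carrier S) : bijective (fun x => QS_op x y).
Proof.
exists (fun x : QS_carrier S => Tagged (fun b => {ideal_quot S b})
  (tagged x - \pi_({ideal_quot S (tag x)}) << tag y >>)).
- by case=> b a; rewrite /QS_op /= addrK.
- by case=> b a; rewrite /QS_op /= subrK.
Qed.

Lemma QS_op_distr (B : choiceType) (S : B -> zmodClosed {freeg B})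
  (w x y : QS_carrier S) : QS_op (QS_op w x) y = QS_op (QS_op w y) (QS_op x y).
Proof. by rewrite /QS_op /= addrAC. Qed.

Definition QS (B : choiceType) (S : B -> zmodClosed {freeg B})
    (S_diag : forall b, << b >> \in S b) : quandle :=
  Quandle (QS_op_idem S_diag) (@QS_op_bij B S) (@QS_op_distr B S).

(* \sum_b n_b b |-> \sum_b n_b f(b): fglift extends its argument linearly. *)
Definition freeg_map (B B' : choiceType) (f : B -> B') :
    {freeg B} -> {freeg B'} :=
  fglift (fun b => << f b >>).

(* Main.v *)
Require Import Defs.
From HB Require Import structures.
From mathcomp Require Import all_boot all_order all_algebra.
From mathcomp Require Import generic_quotient ring_quotient.
From mathcomp Require Import classical_sets.
From mathcomp.multinomials Require Import freeg.

(** The group Z_B acts on Q(S) by translations, z sending x in A_b to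
    x + (z + S_b).  The right multiplication by y in A_c is the translation by
    the generator c, so the quandle operation only records this action
    together with the map Q(S) -> B sending an element to the index of its
    component.  The orbits are the A_b (lemma [QS_orbit]), and the stabilizer
    of any point of A_b is S_b (lemma [QS_stab]).

    Let g be an isomorphism from Q(S) to Q(S'), and let f b be the index of the
    component containing the image of the zero of A_b.  The identity
    g (x |> y) = g x |> g y for y the zero of A_c says that g turns translation
    by c into translation by f c; hence it turns translation by any z into
    translation by f(z) (lemma [morph_QS_act]).  So g maps A_b to the orbit
    A'_(f b), the inverse of g induces the inverse of f, and comparing the
    stabilizers of x and g x shows that z is in S_b iff f(z) is in
    S'_(f b).

    Conversely, a bijection f with f(S_b) = S'_(f b) makes the maps
    z + S_b |-> f(z) + S'_(f b) well defined; they assemble into a morphism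
    ([QS_map]), whose inverse is built in the same way from the inverse of f. *)

Set Implicit Arguments.
Unset Strict Implicit.
Unset Printing Implicit Defensive.

Import GRing.Theory.
Local Open Scope ring_scope.
Local Open Scope classical_set_scope.
Local Open Scope quotient_scope.

(** * Homomorphisms between free abelian groups *)

(** Closure under subtraction alone suffices: an element is a finite sum of
    integer multiples of generators, and sums and opposites are obtained from
    differences and 0. *)
Lemma freeg_ind_zmod (B : choiceType) (P : {freeg B} -> Prop) :
    P 0 -> (forall b, P << b >>) -> (forall z w, P z -> P w -> P (z - w)) ->
  forall z, P z.
Proof.
move=> P0 Pgen PB.
have PN z : P z -> P (- z) by rewrite -sub0r; apply: PB.
have PD z w : P z -> P w -> P (z + w).
  by move=> Pz Pw; rewrite -[w]opprK; apply/PB/PN.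
elim/freeg_ind_dom0 => // k b z _ _ Pz; apply: (PD) => //.
rewrite -[k]intz -freegU_mulz; case: k => n.
  by elim: n => [|n IHn]; rewrite ?mulr0z // intS mulrzDr mulr1z; apply: PD.
rewrite NegzE mulrNz; apply: PN.
by elim: n => [|n IHn]; rewrite ?mulr1z // intS mulrzDr mulr1z; apply: PD.
Qed.

Section FreegMap.
Variables (B B' : choiceType) (f : B -> B').

Lemma freeg_mapB : {morph freeg_map f : z w / z - w}.
Proof. exact: lift_is_additive. Qed.

HB.instance Definition _ :=
  GRing.isZmodMorphism.Build {freeg B} {freeg B'} (freeg_map f) freeg_mapB.

Lemma freeg_mapU b : freeg_map f << b >> = << f b >>.
Proof. by rewrite /freeg_map liftU scale1r. Qed.

End FreegMap.

Lemma freeg_mapK (B B' : choiceType) (f : B -> B') (f' : B' -> B) :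
  cancel f f' -> cancel (freeg_map f) (freeg_map f').
Proof.
move=> fK; elim/freeg_ind_zmod => [|b|z w zK wK].
- by rewrite !raddf0.
- by rewrite !freeg_mapU fK.
- by rewrite !raddfB /= zK wK.
Qed.

(** * The translation action on the quandle *)

Section Action.
Variables (B : choiceType) (S : B -> zmodClosed {freeg B}).
Implicit Types (b c : B) (x y : QS_carrier S) (z w : {freeg B}).

Definition QS_act z x : QS_carrier S :=
  Tagged (fun b => {ideal_quot S b})
    (tagged x + \pi_({ideal_quot S (tag x)}) z).

Definition QS_base b : QS_carrier S :=
  Tagged (fun b => {ideal_quot S b}) (0 : {ideal_quot S b}).

Lemma QS_opE x y : QS_op x y = QS_act << tag y >> x.
Proof. by []. Qed.

Lemma QS_act0 x : QS_act 0 x = x.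
Proof. by case: x => b a; rewrite /QS_act /= raddf0 addr0. Qed.

Lemma QS_actD z w x : QS_act (z + w) x = QS_act z (QS_act w x).
Proof.
by case: x => b a; rewrite /QS_act /= raddfD /= -addrA [\pi w + _]addrC.
Qed.

Lemma QS_actK z : cancel (QS_act z) (QS_act (- z)).
Proof. by move=> x; rewrite -QS_actD addNr QS_act0. Qed.

Lemma QS_orbit x : exists z, x = QS_act z (QS_base (tag x)).
Proof.
by case: x => b a; exists (repr a); rewrite /QS_act /QS_base /= add0r reprK.
Qed.

Lemma QS_stab z x : QS_act z x = x <-> z \in S (tag x).
Proof.
rewrite -[z in z \in _]subr0 Quotient.idealrBE [\pi 0]raddf0.
case: x => b a; rewrite /QS_act /=; split=> [E|/eqP ->]; last by rewrite addr0.
by have /eqP := eq_from_Tagged E; rewrite addrC -subr_eq0 addrK.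
Qed.

End Action.

(** * From isomorphisms to bijections of the bases *)

Section FromMorphism.
Variables (B B' : choiceType).
Variables (S : B -> zmodClosed {freeg B}) (S' : B' -> zmodClosed {freeg B'}).
Variable g : QS_carrier S -> QS_carrier S'.
Hypothesis gM : {morph g : x y / QS_op x y >-> QS_op x y}.

Definition QS_index b := tag (g (QS_base S b)).

(** On a generator c this is the morphism property at the zero of A_c; the set
    of z for which it holds is closed under subtraction since translations are
    bijective. *)
Lemma morph_QS_act z x :
  g (QS_act z x) = QS_act (freeg_map QS_index z) (g x).
Proof.
elim/freeg_ind_zmod: z x => [x|c x|z w Pz Pw x].
- by rewrite raddf0 !QS_act0.
- by rewrite freeg_mapU -(QS_opE _ (g (QS_base S c))) -gM.
(* It suffices to compare both sides after translating them by the image of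
   w. *)
apply: (can_inj (QS_actK (freeg_map QS_index w))).
rewrite -Pw -!QS_actD raddfB /=.
by rewrite [w + _]addrC [freeg_map _ w + _]addrC !subrK Pz.
Qed.

Lemma tag_morph x : tag (g x) = QS_index (tag x).
Proof. by have [z {1}->] := QS_orbit x; rewrite morph_QS_act. Qed.

(** An injective g identifies the stabilizers of the zero of A_b and of its
    image. *)
Lemma morph_QS_stab z b : injective g ->
  (z \in S b) = (freeg_map QS_index z \in S' (QS_index b)).
Proof.
move=> g_inj; apply/idP/idP.
  by move=> /(QS_stab z (QS_base S b)) zx; apply/QS_stab; rewrite -morph_QS_act zx.
move=> /(QS_stab _ (g (QS_base S b))); rewrite -morph_QS_act => /g_inj.
by move/QS_stab.
Qed.

End FromMorphism.

(** The image of the zero of A_b under g need not be the zero of its component,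
    but h sends the whole component back into A_b. *)
Lemma QS_indexK (B B' : choiceType)
    (S : B -> zmodClosed {freeg B}) (S' : B' -> zmodClosed {freeg B'})
    (g : QS_carrier S -> QS_carrier S') (h : QS_carrier S' -> QS_carrier S) :
    {morph h : x y / QS_op x y >-> QS_op x y} -> cancel g h ->
  cancel (QS_index g) (QS_index h).
Proof. by move=> hM gK b; rewrite -(tag_morph hM) gK. Qed.

(** * From bijections of the bases to isomorphisms *)

Section Map.
Variables (B B' : choiceType) (f : B -> B').
Variables (S : B -> zmodClosed {freeg B}) (S' : B' -> zmodClosed {freeg B'}).

Definition QS_map (x : QS_carrier S) : QS_carrier S' :=
  QS_act (freeg_map f (repr (tagged x))) (QS_base S' (f (tag x))).

Hypothesis fS : forall b z, z \in S b -> freeg_map f z \in S' (f b).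

(** The choice of representatives in [QS_map] is immaterial, because f maps
    S_b into S'_(f b). *)
Lemma QS_map_act z b :
  QS_map (QS_act z (QS_base S b)) = QS_act (freeg_map f z) (QS_base S' (f b)).
Proof.
rewrite /QS_map /QS_act /= !add0r; congr Tagged; apply/eqP.
rewrite -Quotient.idealrBE -raddfB; apply: fS.
by rewrite Quotient.idealrBE reprK.
Qed.

Lemma QS_map_morph : {morph QS_map : x y / QS_op x y >-> QS_op x y}.
Proof.
move=> x y; have [z ->] := QS_orbit x.
rewrite !QS_opE -QS_actD !QS_map_act -QS_actD; congr QS_act.
by rewrite raddfD /= freeg_mapU.
Qed.

End Map.

Lemma QS_mapK (B B' : choiceType) (f : B -> B') (f' : B' -> B)
    (S : B -> zmodClosed {freeg B}) (S' : B' -> zmodClosed {freeg B'}) :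
    (forall b z, z \in S b -> freeg_map f z \in S' (f b)) ->
    (forall b' z', z' \in S' b' -> freeg_map f' z' \in S (f' b')) ->
    cancel f f' ->
  cancel (@QS_map B B' f S S') (@QS_map B' B f' S' S).
Proof.
move=> fS f'S' fK x; have [z ->] := QS_orbit x.
by rewrite !QS_map_act // freeg_mapK // fK.
Qed.

Theorem proposition13 (B B' : choiceType)
    (B_nonempty : inhabited B) (B'_nonempty : inhabited B')
    (S : B -> zmodClosed {freeg B}) (S' : B' -> zmodClosed {freeg B'})
    (S_diag : forall b : B, << b >> \in S b)
    (S'_diag : forall b' : B', << b' >> \in S' b') :
  quandle_iso (QS S_diag) (QS S'_diag) <->
  exists2 f : B -> B', bijective f &
    forall b : B, freeg_map f @` [set` S b] = [set` S' (f b)].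
Proof.
split=> [[g [h gK hK] gM]|[f [f' fK f'K] fS]].
  have hM : {morph h : x y / QS_op x y >-> QS_op x y}.
    by move=> x y; rewrite -{1}[x]hK -{1}[y]hK -[QS_op _ _]gM gK.
  have fK := QS_indexK hM gK; have f'K := QS_indexK gM hK.
  exists (QS_index g) => [|b]; first by exists (QS_index h).
  apply/seteqP; split=> [_ [z /= zS <-]|z' /= z'S'].
    by rewrite -(morph_QS_stab gM) //; apply: can_inj gK.
  exists (freeg_map (QS_index h) z'); last exact: freeg_mapK.
  by rewrite /= (morph_QS_stab gM) ?freeg_mapK //; apply: can_inj gK.
have fS1 b z : z \in S b -> freeg_map f z \in S' (f b).
  move=> zS; suff: [set` S' (f b)] (freeg_map f z) by [].
  by rewrite -fS; exists z.
have f'S' b' z' : z' \in S' b' -> freeg_map f' z' \in S (f' b').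
  rewrite -{1}[b']f'K => z'S'.
  have : [set` S' (f (f' b'))] z' by [].
  by rewrite -fS => -[z /= zS <-]; rewrite freeg_mapK.
exists (@QS_map B B' f S S'); last exact: QS_map_morph.
exists (@QS_map B' B f' S' S); exact: QS_mapK.
Qed.
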